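(* Let $f:\mathbb{R}\to\mathbb{R}$ be a lower semicontinuous function, and denote $C_f=\{x\in\mathbb{R}: 0\in\partial f(x)\}$. Then $\mathcal{L}^1\bigl(f(C_f)\bigr)=0$.
   Context: $\mathcal{L}^1$ denotes Lebesgue outer measure on $\mathbb{R}$. For $f:\mathbb{R}\to\mathbb{R}$ and $x\in\mathbb{R}$, $\partial f(x)$ is the (first order, viscosity) subdifferential: the set of all $\zeta\in\mathbb{R}$ such that $$\liminf_{t\to 0}\frac{f(x+t)-f(x)-\zeta t}{|t|}\geq 0.$$ *)

(* Defs.v *)
From HB Require Import structures.
From mathcomp Require Import all_boot all_order all_algebra.
From mathcomp Require Import all_classical all_reals all_analysis.
Import Order.TTheory GRing.Theory Num.Theory.
Import numFieldNormedType.Exports.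
Set Implicit Arguments.
Unset Strict Implicit.
Unset Printing Implicit Defensive.
Local Open Scope classical_set_scope.
Local Open Scope ring_scope.

(* [mu_ext] is defined on every set, by countable covers with half-open
   intervals ]a, b]; no measurability is required of its argument. *)
Definition lebesgue_outer_measure (R : realType) (A : set R) : \bar R :=
  mu_ext (wlength (idfun : R -> R)) A.

(* [lime_inf] ranges over punctured neighborhoods, so the value of the quotient
   at t = 0 is irrelevant. *)
Definition subdifferential (R : realType) (f : R -> R) (x : R) : set R :=
  [set zeta | (0 <= lime_inf
     (fun t : R => ((f (x + t) - f x - zeta * t) / `|t|)%:E) 0)%E].

Definition subcritical_points (R : realType) (f : R -> R) : set R :=
  [set x | subdifferential f x 0].

(* Main.v *)
(** Fix e > 0. If 0 is a subgradient of f at x, then x lies in one of the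
    increasing sets A_n = {x | f (x + t) >= f x - e |t| for |t| < 1/(n+1)}.
    Exchanging the roles of two points of A_n shows that f is e-Lipschitz on
    A_n at scale 1/(n+1); hence the image of the part of A_n in a unit interval
    has outer measure at most 2e, uniformly in n. The A_n need not be
    measurable, so the passage to their union uses G_delta hulls. Finally
    e tends to 0, and countably many unit intervals cover the line. *)
Require Import Defs.
From HB Require Import structures.
From mathcomp Require Import all_boot all_order all_algebra.
From mathcomp Require Import all_classical all_reals all_analysis.
From mathcomp Require Import lra.
Import Order.TTheory GRing.Theory Num.Theory.
Import numFieldNormedType.Exports.
Local Open Scope classical_set_scope.
Local Open Scope ring_scope.

Set Implicit Arguments.
Unset Strict Implicit.
Unset Printing Implicit Defensive.

(** Continuity from below reaches nonmeasurable sets because each [E n] lies in a measurable hull of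
    equal outer measure; the limit is taken along measurable sets squeezed between [E n] and its
    hull. *)
Lemma outer_measure_bigcup_le (R : realType) (E : (set R)^nat) (c : \bar R) :
  nondecreasing_seq E -> (forall n, lebesgue_outer_measure (E n) <= c)%E ->
  (lebesgue_outer_measure (\bigcup_n E n) <= c)%E.
Proof.
move=> ndE Ec.
have /choice[G HG] n : exists G : set R, [/\ measurable G, E n `<=` G &
    (lebesgue_measure G <= c)%E].
  have [U [oU EU muU]] := outer_measure_Gdelta (E n).
  exists (\bigcap_i U i); split => //; last by rewrite muU; exact: Ec.
  by apply: bigcapT_measurable => i; exact: measurable_realfun.open_measurable.
(* The hulls G n need not be monotone; their tail intersections are. *)
pose H n := \bigcap_(m in [set m | (n <= m)%N]) G m.
have mH n : measurable (H n).
  by apply: bigcap_measurable => [|m _]; [exists n => /=|have [] := HG m].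
have HHG n : H n `<=` G n by apply: bigcap_inf => /=.
have EH n : E n `<=` H n.
  move=> y Ey m /= nm; have [_ + _] := HG m; apply.
  by have /subsetPset := ndE _ _ nm; apply.
apply: (@le_trans _ _ (lebesgue_measure (\bigcup_n H n))).
  apply: le_outer_measure => y [n _ Ey]; exists n => //; exact: EH.
have cvH : lebesgue_measure \o H @ \oo --> lebesgue_measure (\bigcup_n H n).
  apply: nondecreasing_cvg_mu => //; first exact: bigcupT_measurable.
  move=> n m nm; apply/subsetPset => y Hy k /= mk; apply: Hy => /=.
  exact: leq_trans mk.
rewrite -(cvg_lim _ cvH)//; apply: lime_le; first by apply/cvg_ex; eexists; exact: cvH.
apply: nearW => n /=; have [mG _ Gc] := HG n.
by apply: le_trans Gc; apply: le_measure; rewrite ?inE//; exact: mH.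
Qed.

(** The factor 2 comes from enclosing [B] in a closed interval of radius [r] centred at one of its
    own points. *)
Lemma outer_measure_diameter_le (R : realType) (B : set R) (r : R) :
  0 <= r -> (forall u v, B u -> B v -> `|u - v| <= r) ->
  (lebesgue_outer_measure B <= (2 * r)%:E)%E.
Proof.
move=> r0 Br; have [->|/set0P[u Bu]] := eqVneq B set0.
  by rewrite /lebesgue_outer_measure outer_measure0 lee_fin mulr_ge0.
apply: (@le_trans _ _ (lebesgue_measure `[u - r, u + r])).
  apply: le_outer_measure => v Bv /=; rewrite in_itv/= -ler_distlC.
  exact: Br.
rewrite lebesgue_measure_itv/= lte_fin; case: ifP => _; last first.
  by rewrite lee_fin mulr_ge0.
by rewrite -EFinB lee_fin; lra.
Qed.

Definition descent_bounded (R : realType) (f : R -> R) (e : R) (n : nat) : set R :=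
  [set x | forall t, `|t| < n.+1%:R^-1 -> f x - e * `|t| <= f (x + t)].

Lemma nondecreasing_descent_bounded (R : realType) (f : R -> R) (e : R) :
  nondecreasing_seq (descent_bounded f e).
Proof.
move=> n m nm; apply/subsetPset => x Ax t tm; apply: Ax.
by apply: lt_le_trans tm _; rewrite lef_pV2 ?posrE// ler_nat.
Qed.

Lemma subcritical_descent_bounded (R : realType) (f : R -> R) (x e : R) :
  0 < e -> subcritical_points f x -> exists n, descent_bounded f e n x.
Proof.
move=> e0; rewrite /subcritical_points/= /subdifferential/= /lime_inf oppe_ge0.
move=> sup_le0; have epos : (0 < e%:E)%E by rewrite lte_fin.
(* The lower limit is minus an infimum, over punctured neighborhoods, of suprema of the negated
   quotient. That infimum is below [e], so one neighborhood [V] already has supremum below [e]. *)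
have /ereal_inf_lt[_ /= [V [r /= r0 rV] <-] supe] := le_lt_trans sup_le0 epos.
have [n _ nr] := near_infty_natSinv_lt (PosNum r0).
(* [V] is punctured, so t = 0 is treated apart; the bound is trivial there. *)
exists n => t tn; have [->|t0] := eqVneq t 0.
  by rewrite normr0 mulr0 subr0 addr0.
have Vt : V t.
  apply: rV => //=; rewrite /ball_/= sub0r normrN (lt_trans tn)//.
  exact: (nr n (leqnn n)).
have := le_lt_trans (ereal_sup_ubound (imageP _ Vt)) supe.
rewrite lte_fin mul0r subr0 -mulNr ltr_pdivrMr ?normr_gt0// => /ltW.
by rewrite opprB lerBlDr lerBlDl addrC.
Qed.

(** Cut the unit interval into n + 1 pieces of length 1/(n+1). The image of each piece of the set
    has diameter at most e/(n+1), so the n + 1 bounds 2e/(n+1) add up to 2e. *)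
Lemma outer_measure_image_descent_bounded (R : realType) (f : R -> R) (e a : R)
    (n : nat) : 0 <= e ->
  (lebesgue_outer_measure (f @` (descent_bounded f e n `&` `[a, (a + 1)%R[))
    <= (2 * e)%:E)%E.
Proof.
move=> e0; set A := descent_bounded f e n.
pose m : R := n.+1%:R.
have m0 : 0 < m by rewrite ltr0n.
(* Half-open pieces keep two points of one piece strictly closer than 1/m, as [descent_bounded]
   demands. *)
pose J (i : nat) : set R := `[a + i%:R / m, a + i.+1%:R / m[%classic.
have cover : f @` (A `&` `[a, (a + 1)[) `<=`
    \big[setU/set0]_(i < n.+1) (f @` (A `&` J i)).
  move=> _ [x [Ax +] <-]; rewrite /= in_itv/= => /andP[ax xa].
  (* The piece containing x has index floor((x - a) m), which is below n + 1 because x < a + 1. *)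
  have xm0 : 0 <= (x - a) * m by rewrite mulr_ge0 ?subr_ge0// ltW.
  have /andP[k1 k2] := truncn_itv xm0.
  set k := Num.truncn _ in k1 k2.
  have kn : (k < n.+1)%N.
    rewrite -(ltr_nat R) (le_lt_trans k1)// -[ltRHS]mul1r ltr_pM2r// ltrBlDr.
    by rewrite addrC.
  rewrite -(bigcup_mkord n.+1 (fun i => f @` (A `&` J i))).
  exists k => //; exists x => //; split => //.
  by rewrite /J/= in_itv/= -lerBrDl -ltrBlDl ler_pdivrMr// ltr_pdivlMr// k1.
apply: le_trans; first by apply: le_outer_measure; exact: cover.
apply: (le_trans (outer_measure_subadditive _ (fun i => f @` (A `&` J i)) _)).
apply: (@le_trans _ _ (\sum_(i < n.+1) (2 * (e / m))%:E)%E); last first.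
  rewrite sumEFin lee_fin sumr_const card_ord -mulrnAr -(mulr_natr (e / m)).
  by rewrite divfK ?gt_eqF.
apply: lee_sum => i _; apply: outer_measure_diameter_le.
  by rewrite divr_ge0// ltW.
have close x y : J i x -> J i y -> `|x - y| < m^-1.
  rewrite /J/= !in_itv/= -(addn1 i) natrD mulrDl mul1r ltr_norml.
  move: (i%:R / m) m^-1 => p q /andP[x1 x2] /andP[y1 y2].
  by apply/andP; split; lra.
(* Apply the descent bound at x with t = y - x; exchanging x and y later gives the absolute
   value. *)
have lip x y : A x -> J i x -> J i y -> f x - f y <= e / m.
  move=> Ax Jx Jy; have xy := close _ _ Jy Jx.
  have := Ax _ xy; rewrite subrKC lerBlDr -lerBlDl => /le_trans; apply.
  by rewrite ler_wpM2l// ltW.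
move=> _ _ [x [Ax Jx] <-] [y [Ay Jy] <-]; rewrite ler_norml lip// andbT.
by rewrite lerNl opprB lip.
Qed.

Theorem proposition1p11 (R : realType) (f : R -> R)
    (lscf : lower_semicontinuous (fun x : R => (f x)%:E)) :
  lebesgue_outer_measure (f @` subcritical_points f) = 0%E.
Proof.
(* [a] enumerates the integers; a code that decodes to nothing only repeats the interval at 0. *)
pose a (k : nat) : R := (odflt 0 (unpickle k : option int))%:~R.
pose F k := f @` (subcritical_points f `&` `[a k, (a k + 1)[).
have imF : f @` subcritical_points f `<=` \bigcup_k F k.
  move=> _ [x Cx <-]; exists (pickle (Num.floor x)) => //; exists x => //.
  split => //; rewrite /a pickleK/= in_itv/= floor_le_tmp/=.
  by rewrite -{2}[1]/(1%:~R) -intrD floorD1_gt.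
apply/negligible_outer_measure; apply: (@negligibleS _ _ _ lebesgue_measure _ _ imF).
apply: (@negligible_bigcup _ _ _ lebesgue_measure) => k; apply/negligible_outer_measure.
apply/eqP; rewrite eq_le outer_measure_ge0 andbT.
apply/lee_addgt0Pr => e e0; rewrite add0e.
(* Slope e/2 absorbs the factor 2 in the bound on the image. *)
have e20 : 0 < e / 2 by rewrite divr_gt0.
pose E n := f @` (descent_bounded f (e / 2) n `&` `[a k, (a k + 1)[).
have FE : F k `<=` \bigcup_n E n.
  move=> _ [x [Cx xa] <-]; have [n An] := subcritical_descent_bounded e20 Cx.
  by exists n => //; exists x.
apply: le_trans; first by apply: le_outer_measure; exact: FE.
apply: outer_measure_bigcup_le => [n m nm|n].
  apply/subsetPset; apply: image_subset; apply: setSI.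
  by apply/subsetPset; exact: nondecreasing_descent_bounded.
rewrite [leRHS](_ : _ = (2 * (e / 2))%:E); last by rewrite mulrC divfK.
by apply: outer_measure_image_descent_bounded; exact: ltW.
Qed.
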